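(* Let $k$ be a positive even integer and let $G=(V(G),E(G),w)$ be a connected graph with weight function $w:E(G)\to\mathbb{R}_+$ whose girth is at least $k$. Then for every DFS tree $D$ of $G$, $\mathrm{mac}(G)\ge\frac{w(G)}{2}+\frac{k-1}{2k}w(D)$.
   Context: $\mathbb{R}_+$ denotes the non-negative reals; for a subgraph $H$, $w(H)=\sum_{e\in E(H)}w(e)$. $\mathrm{mac}(G)$ is the maximum total weight of the edges between $A$ and $B$ over all partitions $(A,B)$ of $V(G)$. The girth is the minimum number of edges in a cycle. A DFS tree is a spanning tree produced by depth-first search: choose a root $r$, start with $D=\{r\}$ and $r$ active; at each step, if the active vertex $u$ has a neighbor $v\notin V(D)$, add $v$ and the edge $uv$ to $D$, set $\mathrm{back}(v)=u$ and make $v$ active; otherwise make $\mathrm{back}(u)$ active; stop when $D$ contains all vertices. *)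

(* Defs.v *)
From mathcomp Require Import all_boot all_order all_algebra.
From mathcomp Require Import reals.

Set Implicit Arguments.
Unset Strict Implicit.
Unset Printing Implicit Defensive.

Import Order.TTheory GRing.Theory Num.Theory.
Local Open Scope ring_scope.

(* A finite simple graph is a symmetric irreflexive relation [e] on a finType;
   its edges are the two-element sets [set u; v] with [e u v], and a weight
   function is read only on those sets. *)

Section Graph.
Variables (T : finType) (e : rel T).

Definition edges : {set {set T}} :=
  [set [set p.1; p.2] | p : T * T & e p.1 p.2].

Definition connected_graph : Prop := forall x y : T, connect e x y.

(* [ucycle] also accepts the sequences [::] and [:: u; v] with [e u v]; the
   size condition excludes them. A cycle has as many edges as vertices. *)
Definition graph_cycle (c : seq T) : Prop := ucycle e c /\ (2 < size c)%N.

(* The girth, that is the minimum number of edges in a cycle (infinite for an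
   acyclic graph), is at least k. *)
Definition girth_geq (k : nat) : Prop :=
  forall c : seq T, graph_cycle c -> (k <= size c)%N.

Definition cut (A : {set T}) : {set {set T}} :=
  [set f in edges | (f :&: A != set0) && (f :&: ~: A != set0)].

(* The pair (V(D), E(D)) is the tree built so far. *)
Record dfs_state := DfsState {
  dfs_vertices : {set T};
  dfs_edges : {set {set T}};
  dfs_back : T -> option T;
  dfs_active : T
}.

Definition dfs_init (r : T) : dfs_state :=
  DfsState [set r] set0 (fun=> None) r.

Inductive dfs_step : dfs_state -> dfs_state -> Prop :=
| dfs_extend (V : {set T}) (F : {set {set T}}) (b : T -> option T) (u v : T) :
    e u v -> v \notin V ->
    dfs_step (DfsState V F b u)
             (DfsState (v |: V) ([set u; v] |: F)
                       [eta b with v |-> Some u] v)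
| dfs_backtrack (V : {set T}) (F : {set {set T}}) (b : T -> option T) (u p : T) :
    (forall v, e u v -> v \in V) -> b u = Some p ->
    dfs_step (DfsState V F b u) (DfsState V F b p).

Inductive dfs_reachable (r : T) : dfs_state -> Prop :=
| dfs_reachable_init : dfs_reachable r (dfs_init r)
| dfs_reachable_step s s' :
    dfs_reachable r s -> dfs_step s s' -> dfs_reachable r s'.

(* A DFS tree is represented by its edge set; its vertex set is all of T. Once
   every vertex is in the tree the edge set no longer changes, so it does not
   matter whether the run continues past the stopping point. *)
Definition dfs_tree (D : {set {set T}}) : Prop :=
  exists r s, [/\ dfs_reachable r s, dfs_vertices s = setT & dfs_edges s = D].

Variables (R : realType) (w : {set T} -> R).

Definition weight (F : {set {set T}}) : R := \sum_(f in F) w f.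

(* The default value 0 is the weight of the cut (set0, setT). *)
Definition mac : R := \big[Num.max/0]_(A : {set T}) weight (cut A).

End Graph.

(* Main.v *)
Require Import Defs.
From mathcomp Require Import all_boot all_order all_algebra.
From mathcomp Require Import reals zify ring lra.

Set Implicit Arguments.
Unset Strict Implicit.
Unset Printing Implicit Defensive.

Import Order.TTheory GRing.Theory Num.Theory.
Local Open Scope ring_scope.

(* Let [d] be the depth in the DFS tree. Choose an offset j < k uniformly, group
   the vertices into blocks by the value of (d v + j) / k, colour each vertex by
   the parity of its depth, and flip each block by an independent fair coin. An
   edge between two blocks is cut with probability 1/2. A tree edge lies inside
   a block for k - 1 of the k offsets, and is then cut, so it is cut with
   probability (k - 1)/k + 1/(2k) = 1/2 + (k - 1)/(2k). The ends of a non-tree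
   edge are in an ancestor relation, and by the girth hypothesis their depths
   differ by at least k - 1; inside a block they differ by exactly k - 1, which
   is odd, so the edge is cut. Hence every non-tree edge is cut with probability
   at least 1/2. *)

(** * Random block flips and the expected cut *)

Section Cuts.
Variables (T : finType) (e : rel T).

Lemma edge_in_edges (x y : T) : e x y -> [set x; y] \in edges e.
Proof. by move=> exy; apply/imsetP; exists (x, y); rewrite ?inE. Qed.

Lemma edge_in_cut (A : {set T}) (x y : T) :
  e x y -> ([set x; y] \in cut e A) = ((x \in A) != (y \in A)).
Proof.
move=> exy; rewrite inE edge_in_edges //=.
have meetE (B : {set T}) : ([set x; y] :&: B != set0) = (x \in B) || (y \in B).
  apply/set0Pn/orP => [[z]|[zB|zB]].
  - by rewrite !inE => /andP[/orP[]/eqP-> ->]; [left|right].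
  - by exists x; rewrite !inE eqxx zB.
  - by exists y; rewrite !inE eqxx orbT zB.
by rewrite !meetE !inE; do 2 case: (_ \in A).
Qed.

(** Toggling coordinate [i] is an involution that exchanges the set with its complement, so both
    have the same size. *)
Lemma card_addb_eq (I : finType) (i j : I) (c : bool) : i != j ->
  (#|[set x : {ffun I -> bool} | (x i (+) x j) == c]|.*2 =
   #|{: {ffun I -> bool}}|)%N.
Proof.
move=> ij; set S := [set x | _].
pose t (x : {ffun I -> bool}) := [ffun l => x l (+) (l == i)].
have tK : involutive t by move=> x; apply/ffunP => l; rewrite !ffunE addbK.
have tS : t @^-1: S = ~: S.
  apply/setP => x; rewrite !inE !ffunE eqxx (eq_sym j) (negbTE ij).
  by case: (x i); case: (x j); case: (c).
have cS : #|~: S| = #|S|.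
  by rewrite -tS on_card_preimset //; exact/onW_bij/inv_bij.
by rewrite -(cardsC S) cS addnn.
Qed.

Variables (R : realType) (w : {set T} -> R).

Lemma weight_cut_le_mac (A : {set T}) : weight w (cut e A) <= mac e w.
Proof. exact: (le_bigmax _ (fun A => weight w (cut e A))). Qed.

(* Flipping the blocks (the fibres of [b]) of the colouring [p] by independent
   fair coins cuts an edge between two blocks with probability 1/2 and does not
   affect the edges inside a block; [g f] bounds from below the probability of
   cutting [f]. *)
Lemma mac_ge_blocks (p : T -> bool) (b : T -> nat) (g : {set T} -> R) :
  (forall f, f \in edges e -> 0 <= w f) ->
  (forall x y, e x y ->
     g [set x; y] <= if b x == b y then (p x != p y)%:R else 2^-1) ->
  \sum_(f in edges e) w f * g f <= mac e w.
Proof.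
move=> w0 gP; pose N := (\max_(x : T) b x)%N.
pose bo x : 'I_N.+1 := inord (b x).
have boE x y : (bo x == bo y) = (b x == b y).
  by rewrite -val_eqE /= !inordK ?ltnS ?leq_bigmax.
pose X : finType := {ffun 'I_N.+1 -> bool}.
pose A (x : X) := [set v | p v (+) x (bo v)].
have X0 : (0 : R) < #|X|%:R by rewrite ltr0n card_ffun card_bool expn_gt0.
have avg : \sum_(x : X) weight w (cut e (A x)) <= #|X|%:R * mac e w.
  rewrite mulr_natl -sumr_const; apply: ler_sum => x _.
  exact: weight_cut_le_mac.
have weightE x : weight w (cut e (A x)) =
    \sum_(f in edges e) w f * (f \in cut e (A x))%:R.
  rewrite /weight [LHS]big_mkcond [RHS]big_mkcond; apply: eq_bigr => f _.
  case: ifPn => [fc|_]; last by rewrite mulr0 if_same.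
  by move: fc; rewrite inE => /andP[-> _]; rewrite mulr1.
rewrite -(ler_pM2l X0); apply: le_trans avg.
rewrite (eq_bigr _ (fun x _ => weightE x)) exchange_big /= mulr_sumr.
apply: ler_sum => f fE; rewrite -mulr_sumr mulrCA.
apply: ler_wpM2l; first exact: w0.
have /imsetP[[x y]] := fE; rewrite inE /= => exy ->.
have cutE z : ([set x; y] \in cut e (A z)) =
    ((z (bo x) (+) z (bo y)) == ~~ (p x (+) p y)).
  rewrite edge_in_cut // !inE.
  by move: (p x) (p y) (z _) (z _) => [] [] [] [].
have cardE : \sum_(z : X) ([set x; y] \in cut e (A z))%:R =
    #|[set z : X | (z (bo x) (+) z (bo y)) == ~~ (p x (+) p y)]|%:R :> R.
  rewrite -sum1_card natr_sum [RHS]big_mkcond; apply: eq_bigr => z _.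
  by rewrite inE cutE; case: ifP.
rewrite cardE; apply: le_trans (ler_wpM2l (ltW X0) (gP _ _ exy)) _.
(* Inside a block the two coins cancel, so the edge is cut by every coin vector or by none. *)
case: ifPn; rewrite -boE => bxy.
  rewrite (eqP bxy) -natrM ler_nat.
  case: (p x =P p y) => [_|pxy]; first by rewrite muln0.
  rewrite muln1 subset_leq_card //; apply/subsetP => z _.
  by rewrite inE addbb; move: (p x) (p y) pxy => [] [].
by rewrite -(card_addb_eq (~~ (p x (+) p y)) bxy) -muln2 natrM mulfK ?pnatr_eq0.
Qed.

End Cuts.

(** * Root paths in a depth-first search *)

Section DepthFirstSearch.
Variables (T : finType) (e : rel T).
Hypotheses (e_sym : symmetric e) (e_irr : irreflexive e).

(* [a x] is the tree path from [x] up to the root. A vertex off the active path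
   is exhausted, so all earlier neighbours of a new vertex are on that path:
   this is why [dp_exhausted] makes [dp_comp] inductive. *)
Record dfs_paths (s : dfs_state T) (a : T -> seq T) : Prop := DfsPaths {
  dp_active : dfs_active s \in dfs_vertices s;
  dp_head x : x \in dfs_vertices s -> exists t, a x = x :: t;
  dp_uniq x : x \in dfs_vertices s -> uniq (a x);
  dp_sub x : x \in dfs_vertices s -> {subset a x <= dfs_vertices s};
  dp_sorted x : x \in dfs_vertices s -> sorted e (a x);
  dp_suffix x y : x \in dfs_vertices s -> y \in a x -> suffix (a y) (a x);
  dp_back x p : x \in dfs_vertices s -> dfs_back s x = Some p ->
    p \in dfs_vertices s /\ a x = x :: a p;
  dp_exhausted x y : x \in dfs_vertices s -> x \notin a (dfs_active s) ->
    e x y -> y \in dfs_vertices s;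
  dp_comp x y : x \in dfs_vertices s -> y \in dfs_vertices s -> e x y ->
    x \in a y \/ y \in a x;
  dp_edge f : f \in dfs_edges s -> exists x p, [/\ x \in dfs_vertices s,
    p \in dfs_vertices s, a x = x :: a p & f = [set x; p]];
  dp_parent x p : x \in dfs_vertices s -> p \in dfs_vertices s ->
    a x = x :: a p -> [set x; p] \in dfs_edges s
}.

Lemma dfs_paths_init r : dfs_paths (dfs_init r) (fun x => [:: x]).
Proof.
split=> //=.
- exact: set11.
- by move=> x _; exists [::].
- by move=> x xr y; rewrite mem_seq1 => /eqP->.
- by move=> x y /set1P->; rewrite mem_seq1 eqxx.
- by move=> x y /set1P-> /set1P-> _; left; rewrite inE.
- by move=> f; rewrite inE.
Qed.

(** An extension prepends the new vertex to the path of the active one to get its path, and keeps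
    the other paths; backtracking changes no path. *)
Lemma dfs_paths_step s s' a : dfs_paths s a -> dfs_step e s s' ->
  exists a', dfs_paths s' a'.
Proof.
move=> P ss'; case: ss' P => [V F b u v euv vV|V F b u p nbu bup]
  [/= uV hd un sub sor suf back exh comp edge par].
  have [tu auE] := hd u uV.
  have [a' a'v a'V] :
      exists2 a', a' v = v :: a u & forall x, x \in V -> a' x = a x.
    exists [eta a with v |-> v :: a u] => [|x xV] /=; first by rewrite eqxx.
    by case: eqP xV vV => // -> ->.
  have vNa x : x \in V -> v \notin a x.
    by move=> xV; apply: contra vV => /(sub x xV).
  exists a'; split=> /=.
  - exact: setU11.
  - move=> x /setU1P[->|xV]; first by rewrite a'v; exists (a u).
    by rewrite a'V //; exact: hd.
  - move=> x /setU1P[->|xV]; last by rewrite a'V //; exact: un.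
    by rewrite a'v /= vNa //; exact: un.
  - move=> x /setU1P[->|xV] y.
      rewrite a'v in_cons => /predU1P[->|/(sub u uV) yV].
        exact: setU11.
      exact: setU1r.
    by rewrite a'V // => /(sub x xV); exact: setU1r.
  - move=> x /setU1P[->|xV]; last by rewrite a'V //; exact: sor.
    by have := sor u uV; rewrite a'v auE /= => ->; rewrite e_sym euv.
  - move=> x y /setU1P[->|xV].
      rewrite a'v in_cons => /predU1P[->|yau]; first by rewrite a'v suffix_refl.
      rewrite a'V; last exact: sub yau.
      apply: (suffix_trans (suf u y uV yau)); exact: (suffix_suffix [:: v]).
    rewrite a'V // => yax; rewrite a'V; last exact: sub yax.
    exact: suf.
  - move=> x q /setU1P[->|xV].
      by rewrite eqxx => -[<-]; rewrite a'v a'V // setU1r.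
    case: eqP => [xv|_ /(back x q xV)[qV axq]]; first by rewrite -xv xV in vV.
    by rewrite !a'V // setU1r.
  - move=> x y /setU1P[->|xV]; rewrite a'v in_cons ?eqxx // negb_or.
    move=> /andP[_ xau] exy.
    by apply: setU1r; exact: exh xau exy.
  (* An old neighbour of [v] off the path of [u] would be exhausted, which would put [v] in [V]
     already. *)
  - have vc y : y \in V -> e v y -> y \in a' v.
      move=> yV evy; rewrite a'v inE; apply/orP; right.
      apply: contraR vV => yau; apply: (exh y) => //; by rewrite e_sym.
    move=> x y /setU1P[->|xV] /setU1P[->|yV] exy.
    + by rewrite e_irr in exy.
    + by right; exact: vc.
    + by left; apply: vc; rewrite // e_sym.
    + by rewrite !a'V //; exact: comp.
  - move=> f /setU1P[->|/edge[x [q [xV qV axq ->]]]].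
      by exists v, u; rewrite a'v a'V // setU11 setU1r // setUC.
    by exists x, q; rewrite !a'V // !setU1r.
  - move=> x q /setU1P[->|xV] /setU1P[->|qV].
    + by rewrite a'v => -[] /(congr1 size) /= /n_Sn.
    + rewrite a'v a'V // => -[]; have [t ->] := hd q qV.
      by rewrite auE => -[-> _]; rewrite setUC setU11.
    + rewrite a'v a'V // => axE; have := vNa x xV.
      by rewrite axE !inE eqxx orbT.
    + by rewrite !a'V // => axE; rewrite setU1r // par.
have [pV auE] := back u p uV bup.
exists a; split=> //= x y xV xap.
(* Only [u] leaves the active path, and the guard of the step says that it is exhausted. *)
have [->|xu] := eqVneq x u; first exact: nbu.
by apply: exh => //; rewrite auE inE negb_or xu.
Qed.

Lemma dfs_paths_reachable r s : dfs_reachable e r s -> exists a, dfs_paths s a.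
Proof.
elim=> [|{}s s' _ [a sa] ss'].
  by exists (fun x => [:: x]); exact: dfs_paths_init.
exact: dfs_paths_step sa ss'.
Qed.

(** The depth of a vertex is the length of its root path. A non-tree edge closes the tree path
    between its ends to a cycle, whose length is the depth difference plus one. *)
Lemma dfs_tree_depth (k : nat) (D : {set {set T}}) :
  girth_geq e k -> dfs_tree e D -> exists d : T -> nat,
  (forall f, f \in D -> exists x y, [/\ f = [set x; y], e x y & d x = (d y).+1])
  /\ (forall x y, e x y -> [set x; y] \notin D ->
       (k <= (d x - d y).+1 \/ k <= (d y - d x).+1)%N).
Proof.
move=> girth [r [s [/dfs_paths_reachable[a P] sT <-]]].
have inV x : x \in dfs_vertices s by rewrite sT inE.
exists (size \o a); split=> [f /(dp_edge P)[x [p [_ _ axp ->]]]|].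
  exists x, p; split=> //=; last by rewrite axp.
  have [t apt] := dp_head P (inV p).
  by have := dp_sorted P (inV x); rewrite axp apt /= => /andP[].
have main x y : e x y -> [set x; y] \notin dfs_edges s -> y \in a x ->
    (k <= (size (a x) - size (a y)).+1)%N.
  move=> exy xyD yx.
  have /suffixP[q axE] := dp_suffix P (inV x) yx.
  have [t ayt] := dp_head P (inV y).
  rewrite axE size_cat addnK.
  have [t' axt'] := dp_head P (inV x).
  case: q axE => [|z q].
    by rewrite axt' ayt => -[xy _]; move: exy; rewrite xy e_irr.
  rewrite axt' => -[xz t'E]; subst z.
  (* If [q] were empty, [y] would be the parent of [x] and the edge would be in the tree. So the
     cycle [y :: x :: q] has at least three vertices. *)
  have qn0 : q != [::].
    apply: contra xyD => /eqP q0; apply: (dp_parent P) => //.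
    by rewrite axt' t'E q0.
  have -> : (size (x :: q)).+1 = size (y :: x :: q) by [].
  apply: girth; split; last by case: (q) qn0.
  have := dp_uniq P (inV x); have := dp_sorted P (inV x).
  rewrite axt' t'E ayt -cat_rcons -cat_cons cat_uniq /= cat_path last_rcons.
  move=> /andP[pq _].
  move=> /andP[uq _].
  rewrite -[_ && _]/(uniq (rcons (x :: q) y)) rcons_uniq in uq.
  by rewrite /ucycle /= e_sym exy pq.
move=> x y exy xyD; have [xy|yx] := dp_comp P (inV x) (inV y) exy.
  by right; apply: main => //; rewrite 1?e_sym // setUC.
by left; exact: main.
Qed.

End DepthFirstSearch.

(** * Averaging over the offset *)

(** The quotient changes from [m + j] to its successor only if [k] divides that successor, and this
    happens for at most one of [k] consecutive values. *)
Lemma sum_same_block (k m : nat) : (0 < k)%N ->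
  (k.-1 <= \sum_(j < k) ((m + j).+1 %/ k == (m + j) %/ k))%N.
Proof.
move=> k0; pose A := [set j : 'I_k | (k %| (m + j).+1)%N].
have -> : (\sum_(j < k) ((m + j).+1 %/ k == (m + j) %/ k) = #|~: A|)%N.
  rewrite -sum1_card [RHS]big_mkcond; apply: eq_bigr => j _.
  by rewrite divnS // !inE; case: (k %| _)%N; rewrite ?eqxx // eqn_leq ltnn.
have /card_le1_eqP A1 : {in A &, forall i, all_equal_to i}.
  move=> i j; rewrite !inE => /dvdnP[q iq] /dvdnP[q' jq].
  apply: val_inj => /=; have := ltn_ord i; have := ltn_ord j.
  by have [qq|qq|qq] := ltngtP q q'; nia.
by have := cardsC A; rewrite card_ord; lia.
Qed.

Theorem theorem4p1 (R : realType) (k : nat) (T : finType) (e : rel T)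
    (w : {set T} -> R) :
  (0 < k)%N -> ~~ odd k ->
  symmetric e -> irreflexive e ->
  (forall f, f \in edges e -> 0 <= w f) ->
  connected_graph e ->
  girth_geq e k ->
  forall D : {set {set T}}, dfs_tree e D ->
    weight w (edges e) / 2 + (k%:R - 1) / (2 * k%:R) * weight w D <= mac e w.

Proof.
move=> k0 kodd e_sym e_irr w0 _ girth D Dtree.
have [d [Dd nDd]] := dfs_tree_depth e_sym e_irr girth Dtree.
have DE : D \subset edges e.
  apply/subsetP => f /Dd[x [y [-> exy _]]]; exact: edge_in_edges.
pose b (j : nat) x := ((d x + j) %/ k)%N.
(* Stated for sets, since [g] has to be a function of the edge and not of an ordered pair of
   ends. *)
pose same j (f : {set T}) := [forall x in f, forall y in f, b j x == b j y].
have sameE j x y : same j [set x; y] = (b j x == b j y).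
  apply/idP/idP => [/forall_inP/(_ x)|bxy].
    rewrite !inE eqxx => /(_ isT)/forall_inP/(_ y).
    by rewrite !inE eqxx orbT => /(_ isT).
  apply/forall_inP => u /set2P ux; apply/forall_inP => v /set2P vx.
  by case: ux vx => -> [] ->; rewrite // eq_sym.
(* This is 1 for a tree edge inside a block and 1/2 for every other edge. *)
pose g j f : R := (1 + ((f \in D) && same j f)%:R) / 2.
(* Two depths in one block differ by at most [k - 1], so here by exactly that, which is odd because
   [k] is even. *)
have gap j x y : (k <= (d x - d y).+1)%N -> b j x = b j y ->
    odd (d x) != odd (d y).
  move=> kxy bxy.
  have := divn_eq (d x + j) k; have := divn_eq (d y + j) k.
  rewrite -/(b j x) -/(b j y) bxy => dyE dxE.
  have ltx := ltn_pmod (d x + j) k0.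
  have dxyE : (d x = d y + k.-1)%N by lia.
  rewrite dxyE oddD; case: (k) kodd k0 => //= k' /negPn-> _.
  by case: odd.
have bound j : \sum_(f in edges e) w f * g j f <= mac e w.
  apply: (mac_ge_blocks (p := odd \o d) (b := b j)) => // x y exy.
  rewrite /g sameE; case: ifPn => bxy; last by rewrite andbF addr0 mul1r.
  rewrite andbT; have [xyD|xyD] := boolP (_ \in D).
    have -> : (odd \o d) x != (odd \o d) y.
      have [x' [y' [xyE ex'y' dxy]]] := Dd _ xyD.
      have /set2P xx : x \in [set x'; y'] by rewrite -xyE set21.
      have /set2P yy : y \in [set x'; y'] by rewrite -xyE set22.
      case: xx yy exy => -> [] ->; rewrite ?e_irr //= dxy /=; by case: odd.
    by rewrite /=; lra.
  have -> : (odd \o d) x != (odd \o d) y.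
    have [h|h] := nDd x y exy xyD; first exact: gap h (eqP bxy).
    by rewrite eq_sym; exact: gap h (esym (eqP bxy)).
  by rewrite /=; lra.
have kR : (0 : R) < k%:R by rewrite ltr0n.
(* Scaling by [k] turns the mean over the offsets into a sum, which is then compared edge by
   edge. *)
rewrite -(ler_pM2l kR).
have : \sum_(j < k) \sum_(f in edges e) w f * g j f <= k%:R * mac e w.
  have -> : k%:R * mac e w = \sum_(j < k) mac e w.
    by rewrite sumr_const card_ord mulr_natl.
  by apply: ler_sum.
apply: le_trans; rewrite exchange_big /=.
have -> : weight w D = \sum_(f in edges e) w f * (f \in D)%:R.
  rewrite /weight [LHS]big_mkcond [RHS]big_mkcond; apply: eq_bigr => f _.
  case: ifPn => [fD|_]; last by rewrite mulr0 if_same.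
  by rewrite (subsetP DE _ fD) mulr1.
rewrite /weight mulr_suml mulr_sumr -big_split /= mulr_sumr.
apply: ler_sum => f fE; rewrite -mulr_sumr.
have -> : k%:R * (w f / 2 + (k%:R - 1) / (2 * k%:R) * (w f * (f \in D)%:R)) =
    w f * ((k%:R + (k%:R - 1) * (f \in D)%:R) / 2).
  by field; rewrite gt_eqF.
apply: ler_wpM2l; first exact: w0.
rewrite /g -mulr_suml big_split /= sumr_const card_ord ler_pM2r ?invr_gt0 //.
(* It remains to see that a tree edge lies inside a block for at least [k - 1] offsets. *)
rewrite lerD2l; case: (boolP (f \in D)) => [fD|_];
  last by rewrite mulr0 sumr_ge0.
rewrite mulr1 /=; have [x [y [fxy _ dxy]]] := Dd _ fD.
have := sum_same_block (d y) k0; rewrite -(ler_nat R) natr_sum -subn1 natrB //.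
move=> /le_trans->//; apply: ler_sum => j _.
by rewrite fxy sameE /b dxy addSn.
Qed.
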